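(* Let $X$ be a real locally convex topological vector space and let $f_1,f_2\colon X\to(-\infty,\infty]$ be proper convex functions such that $\mathrm{dom}(f_1)\cap\mathrm{qri}(\mathrm{dom}(f_2))\neq\emptyset$. Suppose in addition that $f_1$ is polyhedral. Then $$\partial(f_1+f_2)(\bar x)=\partial f_1(\bar x)+\partial f_2(\bar x)\quad\text{for all }\bar x\in\mathrm{dom}(f_1)\cap\mathrm{dom}(f_2).$$
   Context: $\mathrm{dom}(f):=\{x\in X\mid f(x)<\infty\}$ and $\mathrm{epi}(f):=\{(x,\lambda)\in X\times\mathbb{R}\mid f(x)\le\lambda\}$. A subset $P$ of a locally convex space $Z$ is a convex polyhedron if $P=\{z\in Z\mid\langle z_i^*,z\rangle\le\alpha_i,\ i=1,\dots,k\}$ for finitely many $z_i^*\in Z^*$, $\alpha_i\in\mathbb{R}$; $f$ is polyhedral if $\mathrm{epi}(f)$ is a convex polyhedron in $X\times\mathbb{R}$. For a convex set $\Omega$, $\mathrm{qri}(\Omega):=\{x\in\Omega\mid\overline{\mathrm{cone}(\Omega-x)}\text{ is a linear subspace}\}$, where $\mathrm{cone}(A):=\{ta\mid t\ge0,\ a\in A\}$. For convex $f$ and $\bar x\in\mathrm{dom}(f)$, $\partial f(\bar x):=\{x^*\in X^*\mid\langle x^*,x-\bar x\rangle\le f(x)-f(\bar x)\text{ for all }x\in X\}$. *)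

(* Defs.v *)
From mathcomp Require Import all_boot all_order all_algebra.
From mathcomp Require Import all_classical all_reals all_analysis.
Import Order.TTheory GRing.Theory Num.Theory numFieldNormedType.Exports.

Set Implicit Arguments.
Unset Strict Implicit.
Unset Printing Implicit Defensive.

Local Open Scope classical_set_scope.
Local Open Scope ring_scope.

(* Continuous functionals are represented by plain functions, so that they are
   added pointwise and compared by extensional equality. *)
Definition topological_dual (R : realType) (Z : tvsType R) : set (Z -> R^o) :=
  [set phi | linear phi /\ continuous phi].

Definition convex_polyhedron (R : realType) (Z : tvsType R) (P : set Z) : Prop :=
  exists (k : nat) (phi : 'I_k -> Z -> R^o) (alpha : 'I_k -> R),
    (forall i, topological_dual (phi i)) /\
    P = [set z | forall i, (phi i z : R) <= alpha i].

Definition cone_of (R : realType) (Z : tvsType R) (A : set Z) : set Z :=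
  [set t *: a | t in [set t : R | 0 <= t] & a in A].

Definition qri (R : realType) (Z : tvsType R) (Omega : set Z) : set Z :=
  [set x | Omega x /\
    submod_closed (mem (closure (cone_of [set y - x | y in Omega])))].

Section ExtendedFunctions.
Context {R : realType} {X : tvsType R}.
Implicit Types f : X -> \bar R.

Definition efun_dom f : set X := [set x | (f x < +oo)%E].

Definition efun_epi f : set (X * R^o)%type :=
  [set p | (f p.1 <= (p.2 : R)%:E)%E].

Definition efun_proper f : Prop :=
  (forall x, f x != -oo%E) /\ efun_dom f !=set0.

Definition efun_convex f : Prop := forall (x y : X) (t : R), 0 < t < 1 ->
  (f (t *: x + (1 - t) *: y)%R <= t%:E * f x + (1 - t)%:E * f y)%E.

Definition efun_polyhedral f : Prop := convex_polyhedron (efun_epi f).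

Definition subdifferential f (xbar : X) : set (X -> R^o) :=
  [set phi | topological_dual phi /\
    forall x, ((phi (x - xbar)%R : R)%:E <= f x - f xbar)%E].

End ExtendedFunctions.

(* Main.v *)
Require Import Defs.
From mathcomp Require Import all_boot all_order all_algebra.
From mathcomp Require Import all_classical all_reals all_analysis.
From mathcomp Require Import ring lra.
Import Order.TTheory GRing.Theory Num.Theory numFieldNormedType.Exports.
Local Open Scope classical_set_scope.
Local Open Scope ring_scope.

Set Implicit Arguments.
Unset Strict Implicit.
Unset Printing Implicit Defensive.

(** Only the inclusion from left to right needs an idea.  Let phi be a
subgradient of f1 + f2 at xbar.  On the product of X and R, with points (x, r),
the function
  G (x, r) := f2 x + r - phi (x - xbar) - f1 xbar - f2 xbar
is convex on D := dom f2 * R, and the subgradient inequality says that it is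
nonnegative on the part of D lying in epi f1.  As epi f1 is cut out by finitely
many affine inequalities h_i <= 0, a Lagrange multiplier theorem without Slater
point ([system_multiplier]) replaces them by one affine inequality m <= 0 that
follows from them and satisfies G + m >= 0 on the whole of D.  Since G + m is
bounded below along the vertical lines, m has the form p x - r + c; then
m <= 0 on epi f1 says that p + c is an affine minorant of f1, touching f1 at
xbar, so that p is a subgradient of f1, while G + m >= 0 says that phi - p is a
subgradient of f2.

The qualification condition enters in dual form only: if x0 lies in
qri (dom f2), then a continuous functional that attains its minimum over dom f2
at x0 is constant on dom f2, because it is nonnegative on the closed cone
generated by dom f2 - x0, and this cone is symmetric ([qri_nonsupport_point]).
Thus no Hahn-Banach theorem is needed: all separation takes place on the line,
where a multiplier is a number between two families of slopes, and several
constraints are treated one at a time by induction. *)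

(** * Convex functions on a convex set and continuous affine functions *)

(** Convexity of the set and of the function on it go together, so that G may
take arbitrary values outside D. *)
Definition convex_on (R : realType) (Z : tvsType R) (D : set Z) (G : Z -> R) :=
  forall (z w : Z) (t : R), D z -> D w -> 0 < t < 1 ->
    D (t *: z + (1 - t) *: w) /\
    G (t *: z + (1 - t) *: w) <= t * G z + (1 - t) * G w.

Definition continuous_affine (R : realType) (Z : tvsType R) (h : Z -> R) :=
  exists (a : Z -> R^o) (c : R),
    topological_dual a /\ forall z, h z = a z + c.

(** Dual description of quasi-relative interior points: the only hyperplanes
supporting D at z0 are those that contain D. *)
Definition nonsupport_point (R : realType) (Z : tvsType R) (D : set Z)
    (z0 : Z) :=
  D z0 /\ forall psi, continuous_affine psi -> psi z0 = 0 ->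
    (forall z, D z -> 0 <= psi z) -> forall z, D z -> psi z = 0.

Section ContinuousAffine.
Context (R : realType) (Z : tvsType R).
Implicit Types (h : Z -> R) (a b : Z -> R^o).

Lemma topological_dual_comb a b (l : R) :
  topological_dual a -> topological_dual b ->
  topological_dual (fun z => a z + l * b z : R^o).
Proof.
move=> [la ca] [lb cb]; split.
  move=> t u v; rewrite la lb /GRing.scale/=; ring.
move=> z; apply: (@cvgD R R^o); first exact: ca.
by apply: (@cvgM R); [exact: cvg_cst|exact: cb].
Qed.

Lemma topological_dual0 : topological_dual (fun _ : Z => 0 : R^o).
Proof.
split; first by move=> t u v; rewrite /GRing.scale/= mulr0 addr0.
by move=> z; exact: cvg_cst.
Qed.

Lemma continuous_affine0 : continuous_affine (fun _ : Z => 0 : R).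
Proof.
by exists (fun=> 0), 0; split=> [|z]; [exact: topological_dual0|rewrite addr0].
Qed.

Lemma continuous_affine_comb h k (l : R) :
  continuous_affine h -> continuous_affine k ->
  continuous_affine (fun z => h z + l * k z).
Proof.
move=> [a [c [da ha]]] [b [d [db kb]]].
exists (fun z => a z + l * b z), (c + l * d).
split=> [|z]; first exact: topological_dual_comb.
rewrite ha kb; ring.
Qed.

Lemma continuous_affine_conv h z w (t : R) : continuous_affine h ->
  h (t *: z + (1 - t) *: w) = t * h z + (1 - t) * h w.
Proof.
move=> [a [c [[la _] ha]]]; rewrite !ha la.
have -> : a ((1 - t) *: w) = (1 - t) * a w.
  have a0 : a 0 = 0.
    have := la (- 1) 0 0; rewrite scaler0 addr0 /GRing.scale/= mulN1r => ->.
    by rewrite addNr.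
  by have := la (1 - t) w 0; rewrite addr0 a0 addr0 /GRing.scale/=.
rewrite /GRing.scale/=; ring.
Qed.

End ContinuousAffine.

(** * Lagrange multipliers for affine constraints *)

Section Multipliers.
Context (R : realType) (Z : tvsType R).
Implicit Types (D : set Z) (G h m : Z -> R).

Lemma convex_on_affine D G h : convex_on D G -> continuous_affine h ->
  convex_on D h.
Proof.
move=> DG hh z w t Dz Dw t01; split; first by have [] := DG z w t Dz Dw t01.
by rewrite (continuous_affine_conv z w t hh).
Qed.

Lemma convex_on_comb D G h (l : R) : convex_on D G -> continuous_affine h ->
  convex_on D (fun z => G z + l * h z).
Proof.
move=> DG hh z w t Dz Dw t01; have [? Gle] := DG z w t Dz Dw t01; split=> //.
rewrite (continuous_affine_conv z w t hh); lra.
Qed.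

Lemma convex_on_eq0 D G h : convex_on D G -> continuous_affine h ->
  convex_on (D `&` [set z | h z = 0]) G.
Proof.
move=> DG hh z w t [Dz /= hz] [Dw /= hw] t01.
have [? ?] := DG z w t Dz Dw t01; split=> //; split=> //=.
by rewrite (continuous_affine_conv z w t hh) hz hw !mulr0 addr0.
Qed.

Lemma convex_on_system k D G (h : 'I_k -> Z -> R) : convex_on D G ->
  (forall i, continuous_affine (h i)) ->
  convex_on (D `&` [set z | forall i, h i z <= 0]) G.
Proof.
move=> DG hh z w t [Dz /= hz] [Dw /= hw] t01.
have [? ?] := DG z w t Dz Dw t01; split=> //; split=> //= i.
rewrite (continuous_affine_conv z w t (hh i)).
by have := hz i; have := hw i; nra.
Qed.

(** The segment from z to w meets the hyperplane h = 0, where G is nonnegative;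
convexity of G along the segment turns this into a comparison of the slopes on
the two sides of the hyperplane. *)
Lemma cross_slope D G h z w : convex_on D G -> continuous_affine h ->
  (forall z, D z -> h z = 0 -> 0 <= G z) ->
  D z -> D w -> h z < 0 -> 0 < h w -> - G w / h w <= G z / - h z.
Proof.
move=> DG hh G0 Dz Dw hz hw; have d0 : 0 < h w - h z by lra.
(* With this weight on z the affine function h vanishes. *)
pose t := h w / (h w - h z).
have t01 : 0 < t < 1.
  by rewrite /t divr_gt0//= ltr_pdivrMr// mul1r; lra.
have tE : t * (h w - h z) = h w by rewrite /t divfK// gt_eqF.
have [Dv Gv] := DG z w t Dz Dw t01.
have hv : h (t *: z + (1 - t) *: w) = 0.
  by rewrite (continuous_affine_conv z w t hh); lra.
have {Gv} Gv := le_trans (G0 _ Dv hv) Gv.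
rewrite ler_pdivlMr ?oppr_gt0// mulrAC ler_pdivrMr//.
have : 0 <= (t * G z + (1 - t) * G w) * (h w - h z).
  by rewrite mulr_ge0// ltW.
have -> : (t * G z + (1 - t) * G w) * (h w - h z) =
  t * (h w - h z) * G z + ((h w - h z) - t * (h w - h z)) * G w by ring.
rewrite tE; lra.
Qed.

Lemma le_between (A B : set R) : A !=set0 -> B !=set0 ->
  (forall a b, A a -> B b -> a <= b) ->
  exists l, (forall a, A a -> a <= l) /\ (forall b, B b -> l <= b).
Proof.
move=> A0 [b0 Bb0] AB; exists (sup A); split=> [a Aa|b Bb].
  by apply: ub_le_sup => //; exists b0 => x Ax; exact: AB.
by apply: ge_sup => // a Aa; exact: AB.
Qed.

Lemma multiplier_from_slopes D G h (l : R) :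
  (forall z, D z -> h z = 0 -> 0 <= G z) ->
  (forall w, D w -> 0 < h w -> - G w / h w <= l) ->
  (forall z, D z -> h z < 0 -> l <= G z / - h z) ->
  forall z, D z -> 0 <= G z + l * h z.
Proof.
move=> G0 lw lz z Dz; case: (ltrgtP (h z) 0) => hz.
- have := lz z Dz hz; rewrite ler_pdivlMr ?oppr_gt0//; lra.
- have := lw z Dz hz; rewrite ler_pdivrMr//; lra.
- by rewrite hz mulr0 addr0; exact: G0.
Qed.

(** The slopes - G w / h w bound the multiplier from below, and the slopes
G z / - h z from above; the point z1 makes the second family nonempty.  Adding 0
to the first family forces the multiplier to be nonnegative. *)
Lemma slater_multiplier D G h z1 : convex_on D G -> continuous_affine h ->
  (forall z, D z -> h z <= 0 -> 0 <= G z) -> D z1 -> h z1 < 0 ->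
  exists2 l : R, 0 <= l & forall z, D z -> 0 <= G z + l * h z.
Proof.
move=> DG hh G0 Dz1 hz1.
have G00 z : D z -> h z = 0 -> 0 <= G z by move=> Dz hz; rewrite G0// hz.
pose A := [set 0] `|` [set - G w / h w | w in [set w | D w /\ 0 < h w]].
pose B := [set G z / - h z | z in [set z | D z /\ h z < 0]].
have [|||l [lA lB]] := @le_between A B.
- by exists 0; left.
- by exists (G z1 / - h z1), z1.
- move=> _ _ [->|[w [Dw hw] <-]] [z [Dz hz] <-].
    by rewrite divr_ge0 ?oppr_ge0 ?(ltW hz)// G0 ?ltW.
  exact: (cross_slope DG).
exists l; first by apply: lA; left.
apply: multiplier_from_slopes => // [w Dw hw|z Dz hz].
  by apply: lA; right; exists w.
by apply: lB; exists z.
Qed.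

(** For an equality constraint no Slater point is needed: since z0 is a
nonsupport point, h either vanishes on D, and then any multiplier does, or takes
both signs there, and then both families of slopes are nonempty. *)
Lemma equality_multiplier D G h z0 : convex_on D G -> continuous_affine h ->
  nonsupport_point D z0 -> h z0 = 0 ->
  (forall z, D z -> h z = 0 -> 0 <= G z) ->
  exists l : R, forall z, D z -> 0 <= G z + l * h z.
Proof.
move=> DG hh [Dz0 reg] hz0 G0.
have flat : (forall z, D z -> h z = 0) ->
    exists l : R, forall z, D z -> 0 <= G z + l * h z.
  by move=> h0; exists 0 => z Dz; rewrite mul0r addr0 G0// h0.
have [[z1 [Dz1 hz1]]|noneg] := pselect (exists z, D z /\ h z < 0); last first.
  apply: flat; apply: reg => // z Dz; rewrite leNgt; apply/negP => hz.
  by apply: noneg; exists z.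
have [[w1 [Dw1 hw1]]|nopos] := pselect (exists w, D w /\ 0 < h w); last first.
  apply: flat => w Dw.
  have hN := continuous_affine_comb (- 1) (continuous_affine0 Z) hh.
  have -> : h w = - (0 + - 1 * h w) by rewrite add0r mulN1r opprK.
  rewrite (reg _ hN) ?oppr0// ?hz0 ?mulr0 ?addr0// => z Dz.
  rewrite add0r mulN1r oppr_ge0 leNgt; apply/negP => hz.
  by apply: nopos; exists z.
pose A := [set - G w / h w | w in [set w | D w /\ 0 < h w]].
pose B := [set G z / - h z | z in [set z | D z /\ h z < 0]].
have [|||l [lA lB]] := @le_between A B.
- by exists (- G w1 / h w1), w1.
- by exists (G z1 / - h z1), z1.
- by move=> _ _ [w [Dw hw] <-] [z [Dz hz] <-]; exact: (cross_slope DG).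
exists l; apply: multiplier_from_slopes => // [w Dw hw|z Dz hz].
  by apply: lA; exists w.
by apply: lB; exists z.
Qed.

(** A function psi supporting the slice at z0 satisfies psi >= 0 under the
constraint h = 0, so that psi + l h supports D itself for some multiplier l. *)
Lemma nonsupport_point_slice D G h z0 :
  convex_on D G -> continuous_affine h -> nonsupport_point D z0 ->
  h z0 = 0 -> nonsupport_point (D `&` [set z | h z = 0]) z0.
Proof.
move=> DG hh regD hz0; have [Dz0 reg] := regD; split=> // psi psia psi0 psige.
have [||l lpsi] := @equality_multiplier D psi h z0 _ hh regD hz0.
- exact: convex_on_affine DG psia.
- by move=> z Dz hz; exact: psige.
have E := reg _ (continuous_affine_comb l psia hh) _ lpsi.
move=> z [Dz /= hz]; have := E _ z Dz.
by rewrite hz hz0 psi0 !mulr0 !addr0 => ->.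
Qed.

(** By induction on the number of constraints, isolating h0.  If some point
satisfies the other constraints and h0 < 0, the Slater multiplier l turns the
constraint h0 <= 0 into the term l h0 added to G.  Otherwise h0 >= 0 follows
from the other constraints, and the induction hypothesis for h0 in place of G
gives h0 + m' >= 0 on D, with equality at z0.  As z0 is a nonsupport point,
h0 = - m' on D.  The constraint h0 <= 0 is then an equality at feasible points
and can be moved into the domain; its multiplier l has an arbitrary sign, but
when l < 0 the term l h0 coincides on D with - l m', which is nonpositive where
the other constraints hold.  A single consequence m <= 0 of the system stands
for the whole vector of multipliers. *)
Lemma system_multiplier k D G (h : 'I_k -> Z -> R) z0 :
  convex_on D G -> (forall i, continuous_affine (h i)) ->
  nonsupport_point D z0 -> (forall i, h i z0 <= 0) ->
  (forall z, D z -> (forall i, h i z <= 0) -> 0 <= G z) ->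
  exists m, [/\ continuous_affine m,
    forall z, (forall i, h i z <= 0) -> m z <= 0 &
    forall z, D z -> 0 <= G z + m z].
Proof.
elim: k D G h => [|k IH] D G h DG hh regD hz0 G0.
  exists (fun=> 0); split=> // [|z Dz]; first exact: continuous_affine0.
  by rewrite addr0; apply: G0 => // -[].
pose h0 := h ord0; pose h' i := h (lift ord0 i).
have hh' i : continuous_affine (h' i) by exact: hh.
have hsplit z : h0 z <= 0 -> (forall i, h' i z <= 0) -> forall i, h i z <= 0.
  move=> h0z h'z i; have [j ->|->] := unliftP ord0 i; last by [].
  exact: h'z.
have h'z0 i : h' i z0 <= 0 by exact: hz0.
have [[z1 [Dz1 [h'z1 h0z1]]]|noslater] :=
    pselect (exists z, D z /\ (forall i, h' i z <= 0) /\ h0 z < 0).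
- pose D' := D `&` [set z | forall i, h' i z <= 0].
  have [|||l l0 lG] := @slater_multiplier D' G h0 z1 _ (hh ord0) _ _ h0z1.
  + exact: convex_on_system.
  + by move=> z [Dz h'z] h0z; apply: G0 => //; exact: hsplit.
  + by [].
  have [||m [ma m0 Gm]] := IH D (fun z => G z + l * h0 z) h' _ hh' regD h'z0.
  + exact: convex_on_comb DG (hh ord0).
  + by move=> z Dz h'z; exact: lG.
  exists (fun z => m z + l * h0 z); split.
  + exact: continuous_affine_comb ma (hh ord0).
  + move=> z hz; have := m0 z (fun i => hz _); have := hz ord0; rewrite -/h0.
    by nra.
  + by move=> z Dz; have := Gm z Dz; lra.
- have h0ge z : D z -> (forall i, h' i z <= 0) -> 0 <= h0 z.
    move=> Dz h'z; rewrite leNgt; apply/negP => h0z.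
    by apply: noslater; exists z.
  have Dz0 : D z0 by case: regD.
  have h0z0 : h0 z0 = 0 by apply/eqP; rewrite eq_le hz0 h0ge.
  have [|m' [m'a m'0 h0m']] := IH D h0 h' _ hh' regD h'z0 h0ge.
    exact: convex_on_affine DG (hh ord0).
  have h0E z : D z -> h0 z + 1 * m' z = 0.
    have [_ reg] := regD; apply: (reg (fun z => h0 z + 1 * m' z)).
    + exact: continuous_affine_comb (hh ord0) m'a.
    + have := h0m' z0 Dz0; have := m'0 z0 h'z0; rewrite h0z0; lra.
    + by move=> w Dw; rewrite mul1r; exact: h0m'.
  pose D0 := D `&` [set z | h0 z = 0].
  have [|||m [ma m0 Gm]] := IH D0 G h' _ hh' _ h'z0.
  + exact: convex_on_eq0 DG (hh ord0).
  + exact: (nonsupport_point_slice DG (hh ord0)).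
  + by move=> z [Dz /= h0z] h'z; apply: G0 => //; apply: hsplit; rewrite ?h0z.
  have [||l lG] := @equality_multiplier D (fun z => G z + 1 * m z) h0 z0
    _ (hh ord0) regD h0z0.
  + exact: convex_on_comb.
  + by move=> z Dz h0z; rewrite mul1r; exact: Gm.
  have [l0|l0] := leP 0 l.
  + exists (fun z => m z + l * h0 z); split.
    * exact: continuous_affine_comb ma (hh ord0).
    * move=> z hz; have := m0 z (fun i => hz _); have := hz ord0.
      by rewrite -/h0; nra.
    * by move=> z Dz; have := lG z Dz; lra.
  + exists (fun z => m z + (- l) * m' z); split.
    * exact: continuous_affine_comb.
    * move=> z hz; have h'z i : h' i z <= 0 by exact: hz.
      by have := m0 z h'z; have := m'0 z h'z; nra.
    * move=> z Dz; have := lG z Dz.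
      have -> : h0 z = - m' z by have := h0E z Dz; lra.
      lra.
Qed.

End Multipliers.

(** * Quasi-relative interior and continuous functionals *)

Section Dual.
Context (R : realType) (X : tvsType R).
Implicit Types (a : X -> R^o) (Omega : set X).

Lemma topological_dualB a x y : topological_dual a -> a (x - y) = a x - a y.
Proof.
by move=> [la _]; rewrite addrC -scaleN1r la scaleN1r addrC.
Qed.

Lemma topological_dual_prod (a : X * R^o -> R^o) : topological_dual a ->
  topological_dual (fun x => a (x, 0)) /\
  forall x r, a (x, r) = a (x, 0) + r * a (0, 1).
Proof.
move=> [la ca]; split.
  split=> [t u v|x].
    by rewrite -la; congr a; apply: injective_projections => /=;
      rewrite ?scaler0 ?addr0.
  apply: (@continuous_comp X (X * R^o)%type R^o (fun y => (y, 0)) a x);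
    last exact: (ca (x, 0)).
  apply: (@cvg_pair _ _ _ _ (nbhs x) (nbhs (0 : R^o))); first exact: cvg_id.
  exact: cvg_cst.
move=> x r; rewrite addrC -la; congr a.
by apply: injective_projections;
  rewrite /= ?scaler0 ?add0r// addr0 /GRing.scale/= mulr1.
Qed.

(** The functional is nonnegative on the cone generated by Omega - x0, hence on
its closure; as this closure is a subspace, it contains x0 - y together with
y - x0. *)
Lemma qri_unsupported Omega x0 a : qri Omega x0 -> topological_dual a ->
  (forall y, Omega y -> 0 <= a (y - x0)) ->
  forall y, Omega y -> a (y - x0) = 0.
Proof.
move=> [_ [L0 Lcomb]] da a_ge0 y Oy.
set C := cone_of _ in L0 Lcomb; have Cy : closure C (y - x0).
  apply: subset_closure; exists 1; first exact: ler01.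
  by exists (y - x0); [exists y|rewrite scale1r].
have C_ge0 z : closure C z -> 0 <= a z.
  have cl : closed (a @^-1` [set r : R^o | 0 <= r]).
    apply: closed_comp; last exact: closed_ge.
    by move=> z' _; have [_] := da; exact.
  have : closure C `<=` a @^-1` [set r : R^o | 0 <= r].
    rewrite [X in _ `<=` X](closure_id _).1//; apply: closure_subset.
    move=> _ [t /= t0 [_ [w Ow <-] <-]] /=.
    have [la _] := da; have := la t (w - x0) 0.
    rewrite addr0 => ->.
    have a0 : a 0 = 0 by rewrite -(subrr (0 : X)) topological_dualB// subrr.
    by rewrite a0 addr0 mulr_ge0// a_ge0.
  exact.
apply/eqP; rewrite eq_le a_ge0// andbT.
have : closure C ((- 1) *: (y - x0) + 0).
  have := Lcomb (- 1) (y - x0) 0; rewrite !inE; apply=> //.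
  by move: L0; rewrite inE.
have aN : a (- (y - x0)) = - a (y - x0).
  by rewrite opprB !topological_dualB// opprB.
by move=> /C_ge0; rewrite addr0 scaleN1r aN oppr_ge0.
Qed.

(** The vertical direction is free, so that a functional bounded below on the
cylinder over Omega depends on the first coordinate only. *)
Lemma qri_nonsupport_point Omega x0 (r0 : R) : qri Omega x0 ->
  nonsupport_point [set z : X * R^o | Omega z.1] (x0, r0).
Proof.
move=> qx0; have [Ox0 _] := qx0; split=> // psi [a [c [da psiE]]].
have [dp aE] := topological_dual_prod da.
set p := fun x => a (x, 0) in dp aE; set b := a (0, 1) in aE.
have {}psiE x r : psi (x, r) = p x + r * b + c by rewrite psiE aE.
rewrite psiE => psi0 psi_ge0.
have b0 : b = 0.
  have := psi_ge0 (x0, r0 + 1) Ox0; have := psi_ge0 (x0, r0 - 1) Ox0.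
  by rewrite !psiE; lra.
rewrite b0 in psiE psi0.
have p_ge0 w : Omega w -> 0 <= p (w - x0).
  move=> Ow; have := psi_ge0 (w, r0) Ow.
  by rewrite psiE topological_dualB//; lra.
move=> [y r] /= Oy; have := qri_unsupported qx0 dp p_ge0 Oy.
by rewrite psiE topological_dualB//; lra.
Qed.

End Dual.

(** * The subdifferential sum rule *)

Section SumRule.
Context (R : realType) (X : tvsType R).
Implicit Types (f : X -> \bar R) (phi : X -> R^o).

Lemma fineK_dom f x : efun_proper f -> efun_dom f x -> (fine (f x))%:E = f x.
Proof.
by move=> [fNy _] fx; apply: fineK; rewrite fin_numE fNy -ltey.
Qed.

Lemma efun_convex_on f phi (c : R) (xbar : X) :
  efun_proper f -> efun_convex f -> topological_dual phi ->
  convex_on [set z : X * R^o | efun_dom f z.1]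
    (fun z => fine (f z.1) + z.2 - phi (z.1 - xbar) - c).
Proof.
move=> fp fc dphi [x r] [y s] t /= fx fy t01.
have := fc x y t t01; rewrite -(fineK_dom fp fx) -(fineK_dom fp fy).
rewrite -!EFinM -EFinD => fle.
have fxy : efun_dom f (t *: x + (1 - t) *: y).
  exact: le_lt_trans fle (ltry _).
split=> //; rewrite -(fineK_dom fp fxy) lee_fin in fle.
have aff := continuous_affine_conv x y t.
have phiE : phi (t *: x + (1 - t) *: y) = t * phi x + (1 - t) * phi y.
  by apply: aff; exists phi, 0; split=> // z; rewrite addr0.
rewrite !(topological_dualB _ _ dphi) phiE.
have arith (u u1 u2 p1 p2 p0 : R) : u <= t * u1 + (1 - t) * u2 ->
    u + (t * r + (1 - t) * s) - (t * p1 + (1 - t) * p2 - p0) - c <=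
    t * (u1 + r - (p1 - p0) - c) + (1 - t) * (u2 + s - (p2 - p0) - c).
  lra.
exact: arith.
Qed.

Lemma subdifferentialP f phi xbar : efun_proper f -> efun_dom f xbar ->
  subdifferential f xbar phi <-> topological_dual phi /\
    forall x, efun_dom f x -> phi (x - xbar) <= fine (f x) - fine (f xbar).
Proof.
move=> fp fxbar; split=> -[dphi le_phi]; split=> // x.
  move=> fx; have := le_phi x; rewrite -(fineK_dom fp fx) -(fineK_dom fp fxbar).
  by rewrite -EFinB lee_fin.
have [fx|] := boolP (f x < +oo)%E.
  rewrite -(fineK_dom fp fx) -(fineK_dom fp fxbar) -EFinB lee_fin.
  exact: le_phi.
rewrite -leNgt leye_eq => /eqP ->.
by rewrite -(fineK_dom fp fxbar) addye// leey.
Qed.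

Lemma efun_dom_add f1 f2 : efun_proper f1 -> efun_proper f2 ->
  efun_dom (fun x => (f1 x + f2 x)%E) = efun_dom f1 `&` efun_dom f2.
Proof.
move=> [f1Ny _] [f2Ny _]; apply/seteqP; split=> x; rewrite /efun_dom/=.
  have := f1Ny x; have := f2Ny x.
  case: (f1 x) => [r| |]; case: (f2 x) => [s| |]//= _ _ _.
  by split; exact: ltry.
by move=> [? ?]; exact: lte_add_pinfty.
Qed.

Lemma subdifferential_addP f1 f2 phi xbar :
  efun_proper f1 -> efun_proper f2 -> (efun_dom f1 `&` efun_dom f2) xbar ->
  subdifferential (fun x => (f1 x + f2 x)%E) xbar phi <->
  topological_dual phi /\
    forall x, efun_dom f1 x -> efun_dom f2 x ->
      phi (x - xbar) <= fine (f1 x) + fine (f2 x)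
                        - (fine (f1 xbar) + fine (f2 xbar)).
Proof.
move=> f1p f2p [d1 d2].
have fp : efun_proper (fun x => (f1 x + f2 x)%E).
  split; last by exists xbar; rewrite efun_dom_add.
  move=> x; rewrite adde_eq_ninfty negb_or; case: f1p f2p => [-> _] [-> _].
  by [].
have fineD x : efun_dom f1 x -> efun_dom f2 x ->
    fine (f1 x + f2 x)%E = fine (f1 x) + fine (f2 x).
  by move=> /(fineK_dom f1p) <- /(fineK_dom f2p) <-.
rewrite (subdifferentialP _ fp); last by rewrite efun_dom_add.
rewrite efun_dom_add// fineD//; split=> -[dphi le_phi]; split=> // x.
  by move=> fx1 fx2; rewrite -fineD//; exact: le_phi.
by move=> [fx1 fx2]; rewrite fineD//; exact: le_phi.
Qed.

(** The multiplier theorem is applied on the cylinder over dom f2, at the point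
(x0, f1 x0) of epi f1.  The affine function m that it provides has slope b = -1
in the vertical direction, since G + m is bounded below on the vertical line
over x0, and its restriction p + c to X separates f1 from phi - f2, up to a
constant. *)
Lemma polyhedral_subdifferential_split f1 f2 phi xbar :
  efun_proper f1 -> efun_proper f2 -> efun_convex f2 ->
  efun_dom f1 `&` qri (efun_dom f2) !=set0 -> efun_polyhedral f1 ->
  (efun_dom f1 `&` efun_dom f2) xbar ->
  subdifferential (fun x => (f1 x + f2 x)%E) xbar phi ->
  exists2 p, subdifferential f1 xbar p &
    subdifferential f2 xbar (fun x => phi x + - 1 * p x).
Proof.
move=> f1p f2p f2c [x0 [fx0 qx0]] [k [a [alpha [da epiE]]]] d12.
have [d1 d2] := d12; move=> /(subdifferential_addP _ f1p f2p d12)[dphi le_phi].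
pose h i (z : X * R^o) : R := a i z - alpha i.
have epiP x (r : R) : (forall i, h i (x, r) <= 0) <-> (f1 x <= r%:E)%E.
  have -> : (f1 x <= r%:E)%E = efun_epi f1 (x, r) :> Prop by [].
  by rewrite epiE; split=> /= hz i; have := hz i; rewrite subr_le0.
pose c1 := fine (f1 xbar); pose c2 := fine (f2 xbar).
have f2cvx := efun_convex_on (c1 + c2) xbar f2p f2c dphi.
have [|||m [[q [c [dq mE]]] m_le0 G_ge0]] :=
  @system_multiplier _ _ k _ _ h (x0, fine (f1 x0)) f2cvx _
    (qri_nonsupport_point (fine (f1 x0)) qx0).
- move=> i; exists (a i), (- alpha i); split=> //; exact: da.
- by apply/epiP; rewrite fineK_dom.
- move=> [x r] /= fx2 /epiP f1xr.
  have fx1 : efun_dom f1 x by exact: le_lt_trans f1xr (ltry _).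
  have := le_phi x fx1 fx2; rewrite -(fineK_dom f1p fx1) lee_fin in f1xr.
  by rewrite -/c1 -/c2; lra.
have [dp qE] := topological_dual_prod dq.
set p := fun x => q (x, 0) in dp qE; set b := q (0, 1) in qE.
have {}mE x r : m (x, r) = p x + r * b + c by rewrite mE qE.
have bE : b = - 1.
  have [//|bN1] := eqVneq b (- 1).
  have b0 : 1 + b != 0 by rewrite addrC -[1]opprK subr_eq0.
  (* Otherwise G + m takes the value -1 on the vertical line over x0. *)
  pose K := fine (f2 x0) - phi (x0 - xbar) - (c1 + c2) + p x0 + c.
  have := G_ge0 (x0, - (K + 1) / (1 + b)) qx0.1; rewrite /= mE => H.
  have E : - (K + 1) / (1 + b) * (1 + b) = - (K + 1) by rewrite divfK.
  by exfalso; move: H E; rewrite /K; lra.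
rewrite {}bE in mE.
have pc_le x : efun_dom f1 x -> p x + c <= fine (f1 x).
  move=> fx; have := m_le0 (x, fine (f1 x)).
  by rewrite mE epiP fineK_dom// lexx => /(_ isT); lra.
have pc_xbar : p xbar + c = c1.
  apply/eqP; rewrite eq_le pc_le//=.
  have := G_ge0 (xbar, 0) d2; rewrite /= mE subrr -/c2.
  by rewrite -(subrr (0 : X)) topological_dualB// subrr; lra.
exists p; first apply/subdifferentialP => //.
  split=> // x fx; rewrite topological_dualB// -/c1.
  by have := pc_le x fx; lra.
apply/subdifferentialP => //; split; first exact: topological_dual_comb.
move=> x fx; rewrite [p (x - _)]topological_dualB// -/c2.
by have := G_ge0 (x, 0) fx; rewrite /= mE; lra.
Qed.

Lemma subdifferential_add f1 f2 p1 p2 xbar :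
  efun_proper f1 -> efun_proper f2 -> (efun_dom f1 `&` efun_dom f2) xbar ->
  subdifferential f1 xbar p1 -> subdifferential f2 xbar p2 ->
  subdifferential (fun x => (f1 x + f2 x)%E) xbar (p1 + p2).
Proof.
move=> f1p f2p d12; have [d1 d2] := d12.
move=> /(subdifferentialP _ f1p d1)[dp1 le1].
move=> /(subdifferentialP _ f2p d2)[dp2 le2].
apply/subdifferential_addP => //; split=> [|x fx1 fx2].
  have -> : p1 + p2 = (fun x => p1 x + 1 * p2 x).
    by apply/funext => x; rewrite mul1r.
  exact: topological_dual_comb.
have := le1 x fx1; have := le2 x fx2.
have -> : (p1 + p2) (x - xbar) = p1 (x - xbar) + p2 (x - xbar) by [].
lra.
Qed.

End SumRule.

Unset Implicit Arguments.

Theorem corollary5p3 (R : realType) (X : tvsType R) (f1 f2 : X -> \bar R)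
    (f1_proper : efun_proper f1) (f1_convex : efun_convex f1)
    (f2_proper : efun_proper f2) (f2_convex : efun_convex f2)
    (dom_qri : efun_dom f1 `&` qri (efun_dom f2) !=set0)
    (f1_polyhedral : efun_polyhedral f1) :
  forall xbar : X, (efun_dom f1 `&` efun_dom f2) xbar ->
    subdifferential (fun x => (f1 x + f2 x)%E) xbar =
    [set phi1 + phi2 | phi1 in subdifferential f1 xbar
                     & phi2 in subdifferential f2 xbar].
Proof.
move=> xbar d12; apply/seteqP; split=> [phi sphi|_ [p1 sp1 [p2 sp2 <-]]].
  have [p sp sq] := polyhedral_subdifferential_split f1_proper f2_proper
    f2_convex dom_qri f1_polyhedral d12 sphi.
  exists p => //; exists (fun x => phi x + - 1 * p x) => //.
  apply/funext => x; rewrite -[LHS]/(p x + (phi x + - 1 * p x)).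
  by rewrite mulN1r addrC subrK.
exact: subdifferential_add.
Qed.
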